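(* Let $G=(V,E)$ be a graph satisfying conditions (G1)–(G3) of the context, let $\omega\in(0,\infty)^E$ be conductances and $\theta:V\to(0,\infty)$ a speed measure. Let $p>(d-1)/2$ and assume that for any $x\in V$, $$m_p:=\limsup_{n\to\infty}\big\|1\vee \mu^\omega/\theta\big\|_{p,B(x,n)}<\infty .$$ Then there exists a constant $c(m_p)>0$ (not depending on the points $x,y$ below) such that the following holds. For every $x\in V$ there exists $N_3(\omega,x)<\infty$ such that for any $y\in V$ with $d(x,y)\ge N_3(\omega,x)$, $$d_\theta^\omega(x,y)\;\ge\; c(m_p)\,d(x,y)^{1-\frac{d-1}{2p}} .$$
   Context: Setting. $G=(V,E)$ is an infinite, connected, locally finite graph with non-oriented edges; $x\sim y$ means $\{x,y\}\in E$. $d(x,y)$ is the graph distance, $B(x,r)=\{y\in V: d(x,y)\le r\}$, and $|A|$ is the cardinality of $A\subset V$. (The symbol $d$ without arguments is a number, the volume growth exponent.) Standing assumptions on $G$: (G1) There is $C_{\mathrm{deg}}\in[1,\infty)$ with $|\{y:y\sim x\}|\le C_{\mathrm{deg}}$ for all $x\in V$. (G2) There are $d\ge2$ and $C_{\mathrm{reg}}\in(0,\infty)$ such that for all $x\in V$ there is $N_1(x)<\infty$ with $C_{\mathrm{reg}}^{-1}n^d\le|B(x,n)|\le C_{\mathrm{reg}}n^d$ for all $n\ge N_1(x)$. (G3) There are $d'\ge d$ and $C_{S_1}\in(0,\infty)$ such that for all $x\in V$ there is $N_2(x)<\infty$ such that for all $n\ge N_2(x)$ and all $u:V\to\mathbb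 R$ with $\operatorname{supp}u\subset B(x,n)$, $$\Big(\sum_{y\in B(x,n)}|u(y)|^{\frac{d'}{d'-1}}\Big)^{\frac{d'-1}{d'}}\le C_{S_1}n^{1-\frac{d}{d'}}\sum_{\{y,z\}\in E,\ \{y,z\}\cap B(x,n)\ne\emptyset}|u(y)-u(z)| .$$ Conductances are positive weights $\omega(e)\in(0,\infty)$, $e\in E$, with $\omega(x,y)=\omega(y,x)=\omega(\{x,y\})$, and $\mu^\omega(x)=\sum_{y\sim x}\omega(x,y)$. The metric $d_\theta^\omega$ is $$d_\theta^\omega(x,y)=\inf_{\gamma}\sum_{i=0}^{l_\gamma-1}\Big(1\wedge\frac{\theta(z_i)\wedge\theta(z_{i+1})}{\omega(z_i,z_{i+1})}\Big)^{1/2},$$ the infimum being over all nearest-neighbour paths $\gamma=(z_0,\dots,z_{l_\gamma})$ with $z_0=x$, $z_{l_\gamma}=y$. Averaged norms: for finite non-empty $B\subset V$ and $p\in[1,\infty)$, $\|f\|_{p,B}=\big(\frac1{|B|}\sum_{x\in B}|f(x)|^p\big)^{1/p}$. Here $a\wedge b=\min(a,b)$, $a\vee b=\max(a,b)$. The constant $c(m_p)$ may also depend on the fixed parameters $p$, $d$ and on the constants of the graph in (G1)–(G3). *)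

(* Defs.v *)
From HB Require Import structures.
From mathcomp Require Import all_boot all_order all_algebra.
From mathcomp Require Import finmap.
From mathcomp Require Import all_classical all_reals all_analysis.

Set Implicit Arguments.
Unset Strict Implicit.
Unset Printing Implicit Defensive.

Import Order.TTheory GRing.Theory Num.Theory.
Local Open Scope classical_set_scope.
Local Open Scope ring_scope.

(* [x :: s] is the sequence of vertices (z_0 = x, ..., z_l = y), l = [size s]. *)
Definition walk (V : eqType) (adj : rel V) (x y : V) (s : seq V) : Prop :=
  path adj x s /\ last x s = y.

Record graph := Graph {
  vertex :> choiceType;
  adj : rel vertex;
  adj_sym : symmetric adj;
  adj_irrefl : irreflexive adj;
  vertex_infinite : infinite_set [set: vertex];
  locally_finite : forall x, finite_set [set y | adj x y];
  connected_graph : forall x y, exists s, walk adj x y s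
}.

Section Graph.
Variable G : graph.
Implicit Types x y z : G.

Definition neighbours x : set G := [set y | adj x y].

Lemma walk_length_ex x y :
  exists n, `[< exists s, walk (@adj G) x y s /\ size s = n >].
Proof.
by have [s xys] := connected_graph x y; exists (size s); apply/asboolP; exists s.
Qed.

Definition gdist x y : nat := ex_minn (walk_length_ex x y).

Definition gball x (n : nat) : set G := [set y | (gdist x y <= n)%N].

(* [fset_set] sends infinite sets to the empty one; [card] is only used on
   balls and neighbourhoods, which are finite by local finiteness. *)
Definition card (A : set G) : nat := #|` fset_set A|.

End Graph.

Section Assumptions.
Variables (R : realType) (G : graph).

Definition condG1 (Cdeg : R) : Prop :=
  forall x : G, (card (neighbours x))%:R <= Cdeg.

Definition condG2 (d Creg : R) : Prop :=
  forall x : G, exists N1 : nat, forall n : nat, (N1 <= n)%N ->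
    Creg^-1 * n%:R `^ d <= (card (gball x n))%:R <= Creg * n%:R `^ d.

(* Oriented edges meeting B; each non-oriented edge appears exactly twice, hence
   the factor 1/2 in [energy1]. *)
Definition edges_meeting (B : set G) : set (G * G) :=
  [set e | adj e.1 e.2 /\ (B e.1 \/ B e.2)].

Definition energy1 (B : set G) (u : G -> R) : R :=
  2^-1 * \sum_(e \in edges_meeting B) `|u e.1 - u e.2|.

Definition condG3 (d d' CS1 : R) : Prop :=
  forall x : G, exists N2 : nat, forall n : nat, (N2 <= n)%N ->
    forall u : G -> R, [set y | u y != 0] `<=` gball x n ->
      (\sum_(y \in gball x n) `|u y| `^ (d' / (d' - 1))) `^ ((d' - 1) / d')
      <= CS1 * n%:R `^ (1 - d / d') * energy1 (gball x n) u.

(* Elements of (0,oo)^E are represented by functions on pairs of vertices, whose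
   values at non-adjacent pairs are irrelevant. *)
Definition conductance (w : G -> G -> R) : Prop :=
  forall x y : G, adj x y -> 0 < w x y /\ w x y = w y x.

Definition mu (w : G -> G -> R) (x : G) : R :=
  \sum_(y \in neighbours x) w x y.

Definition step_length (w : G -> G -> R) (theta : G -> R) (x y : G) : R :=
  Num.sqrt (Num.min 1 (Num.min (theta x) (theta y) / w x y)).

Fixpoint walk_cost (w : G -> G -> R) (theta : G -> R) (x : G) (s : seq G) : R :=
  if s is z :: s' then step_length w theta x z + walk_cost w theta z s' else 0.

Definition dtheta (w : G -> G -> R) (theta : G -> R) (x y : G) : R :=
  inf [set walk_cost w theta x s | s in [set s | walk (@adj G) x y s]].

(* Averaged norm ||f||_{p,B}, for B finite and non-empty. *)
Definition avg_norm (p : R) (B : set G) (f : G -> R) : R :=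
  ((card B)%:R^-1 * \sum_(x \in B) `|f x| `^ p) `^ p^-1.

Definition m_limsup (w : G -> G -> R) (theta : G -> R) (p : R) (x : G) : \bar R :=
  limn_esup (fun n : nat =>
    (avg_norm p (gball x n) (fun z => Num.max 1 (mu w z / theta z)))%:E).

End Assumptions.

(* Main.v *)
Require Import Defs.
From HB Require Import structures.
From mathcomp Require Import all_boot all_order all_algebra.
From mathcomp Require Import finmap lra zify.
From mathcomp Require Import all_classical all_reals all_analysis.

Set Implicit Arguments.
Unset Strict Implicit.
Unset Printing Implicit Defensive.

Import Order.TTheory GRing.Theory Num.Theory.
Local Open Scope classical_set_scope.
Local Open Scope ring_scope.

(** A walk from [x] to a point at distance [n] crosses an edge between the
    spheres of radii [k] and [k + 1] around [x], for every [k < n].  With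
    [f := max 1 (mu / theta)], an edge [{z, z'}] has length at least
    [max (f z) (f z') `^ (- 1/2)], and the chosen edges have distinct lower end
    points and distinct upper end points, so that the sum of [max (f z) (f z') `^ p]
    over them is at most twice the sum of [f `^ p] over the ball, which is
    [O(n `^ d)].  Jensen's inequality for the convex function
    [t |-> t `^ (- 1/(2p))] then bounds the total length from below by a
    multiple of [n * (n `^ d / n) `^ (- 1/(2p))]. *)

(** * Jensen's inequality for negative powers *)

Section PowerMean.
Variable R : realType.
Implicit Types (a A S q : R) (n : nat).

Lemma powRN_ge_tangent a A q : 0 < a -> 0 < A -> 0 <= q ->
  A `^ (- q) * (1 + q - q * (a / A)) <= a `^ (- q).
Proof.
move=> a0 A0 q0; have u0 : 0 < a / A by rewrite divr_gt0.
have -> : a `^ (- q) = A `^ (- q) * (a / A) `^ (- q).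
  by rewrite -powRM ?ltW// mulrCA divff ?mulr1// gt_eqF.
rewrite ler_wpM2l ?powR_ge0//.
rewrite [leRHS]/powR gt_eqF//; apply: le_trans (expR_ge1Dx _).
have : ln (a / A) <= a / A - 1.
  by rewrite -{1}(subrKC 1 (a / A)) le_ln1Dx// ltrBrDl addrN.
nra.
Qed.

(** The tangents are taken at [S / n] instead of the mean of [a]: their slope is nonpositive, so an
    upper bound on the sum of [a] suffices. *)
Lemma sum_powRN_ge (n : nat) (a : nat -> R) S q : (0 < n)%N -> 0 < S -> 0 <= q ->
  (forall k, (k < n)%N -> 0 < a k) -> \sum_(0 <= k < n) a k <= S ->
  n%:R * (S / n%:R) `^ (- q) <= \sum_(0 <= k < n) a k `^ (- q).
Proof.
move=> n0 S0 q0 a0 aS; set A := S / n%:R.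
have nR0 : 0 < n%:R :> R by rewrite ltr0n.
have A0 : 0 < A by rewrite divr_gt0.
apply: (@le_trans _ _ (\sum_(0 <= k < n) A `^ (- q) * (1 + q - q * (a k / A)))).
  rewrite -mulr_sumr mulrC ler_wpM2l ?powR_ge0// sumrB sumr_const_nat subn0.
  rewrite -mulr_sumr -mulr_suml -[_ *+ n]mulr_natr.
  have : (\sum_(0 <= k < n) a k) / A <= n%:R.
    rewrite ler_pdivrMr// /A mulrC divfK//; lra.
  by nra.
by apply: ler_sum_nat => k /andP[_ kn]; apply: powRN_ge_tangent; rewrite ?a0.
Qed.

End PowerMean.

(** * Graph distance and balls *)

Section Graph.
Variable G : graph.
Implicit Types x y z : G.

Lemma gdist_walk x y s : walk (@adj G) x y s -> (gdist x y <= size s)%N.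
Proof.
by move=> xys; rewrite /gdist; case: ex_minnP => n _; apply; apply/asboolP; exists s.
Qed.

Lemma gdist_walk_ex x y : exists2 s, walk (@adj G) x y s & size s = gdist x y.
Proof. by rewrite /gdist; case: ex_minnP => n /asboolP[s [? <-]] _; exists s. Qed.

Lemma gdistxx x : gdist x x = 0%N.
Proof. by apply/eqP; rewrite -leqn0; apply: (@gdist_walk x x [::]). Qed.

Lemma gdist_triangle y x z : (gdist x z <= gdist x y + gdist y z)%N.
Proof.
have [s [sp sl] <-] := gdist_walk_ex x y; have [t [tp tl] <-] := gdist_walk_ex y z.
rewrite -size_cat; apply: gdist_walk; split.
  by rewrite cat_path sp sl.
by rewrite last_cat sl.
Qed.

Lemma gdist_adj x y z : adj y z -> (gdist x z <= (gdist x y).+1)%N.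
Proof.
move=> yz; rewrite -addn1; apply: leq_trans (gdist_triangle y x z) _.
by rewrite leq_add2l; apply: (@gdist_walk y z [:: z]); split; rewrite //= yz.
Qed.

Lemma sub_gball x y m n : (gdist x y + m <= n)%N -> gball y m `<=` gball x n.
Proof.
move=> xyn z /= yz; apply: leq_trans (gdist_triangle y x z) _.
by apply: leq_trans xyn; rewrite leq_add2l.
Qed.

(** Since [card] is zero on infinite sets, the lower volume bound of [condG2] will yield finiteness
    of large balls. *)
Lemma gball_finite x n : (0 < Defs.card (gball x n))%N -> finite_set (gball x n).
Proof.
have [//|inf] := pselect (finite_set (gball x n)).
by rewrite /Defs.card /fset_set; case: pselect.
Qed.

End Graph.

(** * Lower bounds on the cost of a walk *)

Section Walks.
Variables (R : realType) (G : graph).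

Lemma ler_sum_inj (n : nat) (u : nat -> G) (B : set G) (F : G -> R) :
  finite_set B -> (forall z, 0 <= F z) -> (forall k, (k < n)%N -> B (u k)) ->
  {in gtn n &, injective u} ->
  \sum_(0 <= k < n) F (u k) <= \sum_(z \in B) F z.
Proof.
move=> Bfin F0 uB uinj; rewrite fsbig_finite//= -(big_map u xpredT F).
set r := map u _; set t := fset_set B : seq G.
have rt : {subset r <= t}.
  move=> z /mapP[k]; rewrite mem_index_iota => /andP[_ kn] ->.
  by rewrite in_fset_set// inE; apply: uB.
have ur : uniq r.
  rewrite map_inj_in_uniq ?iota_uniq// => i j.
  by rewrite !mem_index_iota => /andP[_ ?] /andP[_ ?]; apply: uinj.
rewrite [leRHS](perm_big (r ++ [seq z <- t | z \notin r])); last first.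
  apply: uniq_perm; first exact: fset_uniq.
    rewrite cat_uniq ur filter_uniq ?fset_uniq// andbT -all_predC all_filter.
    by apply/allP => z _ /=; rewrite implybb.
  move=> z; rewrite mem_cat mem_filter.
  by case: (boolP (z \in r)) => //= /rt.
by rewrite big_cat/= lerDl sumr_ge0.
Qed.

Variables (w : G -> G -> R) (theta : G -> R).

Lemma walk_cost_ge0 x s : 0 <= walk_cost w theta x s.
Proof. by elim: s x => //= z s IH x; rewrite addr_ge0 ?sqrtr_ge0. Qed.

(** The level function [h] will be the distance to a fixed point. It is kept abstract because the
    induction moves the start of the walk but not that point. *)
Lemma walk_crossing (h : G -> nat) (x : G) (s : seq G) (n : nat) :
  (forall y z : G, adj y z -> (h z <= (h y).+1)%N) ->
  path (@adj G) x s -> (n <= h (last x s))%N ->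
  exists2 e : nat -> G * G,
    forall k, (h x <= k < n)%N ->
      [/\ adj (e k).1 (e k).2, h (e k).1 = k & h (e k).2 = k.+1] &
    \sum_(h x <= k < n) step_length w theta (e k).1 (e k).2
      <= walk_cost w theta x s.
Proof.
move=> hadj; elim: s x => [|z s IH] x /=.
  move=> _ nx; exists (fun=> (x, x)); last by rewrite big_geq.
  by move=> k /andP[xk kn]; move: (leq_trans kn (leq_trans nx xk)); rewrite ltnn.
move=> /andP[xz zs] ns; have [e ek ecost] := IH z zs ns.
have step0 : 0 <= step_length w theta x z := sqrtr_ge0 _.
have [nx|xn] := leqP n (h x).
  exists e; last by rewrite big_geq// addr_ge0 ?walk_cost_ge0.
  by move=> k /andP[xk kn]; move: (leq_trans kn (leq_trans nx xk)); rewrite ltnn.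
(* If the first edge does not climb, the tail already crosses all levels from [h x] on; its lower
   levels are dropped. Otherwise that edge climbs by exactly one and serves level [h x]. *)
have [zx|xz'] := leqP (h z) (h x).
  exists e; first by move=> k /andP[xk kn]; apply: ek; rewrite kn (leq_trans zx).
  apply: ler_wpDl => //; apply: le_trans ecost.
  by rewrite [leRHS](big_cat_nat zx (ltnW xn))/= lerDr sumr_ge0// => k _; apply: sqrtr_ge0.
have hz : h z = (h x).+1 by apply/eqP; rewrite eqn_leq hadj.
exists (fun k => if k == h x then (x, z) else e k) => [k /andP[xk kn]|].
  case: eqVneq => [->//|kx]; apply: ek.
  by rewrite kn hz ltn_neqAle eq_sym kx xk.
rewrite big_ltn// eqxx lerD2l -hz; apply: le_trans ecost.
rewrite le_eqVlt; apply/orP; left; apply/eqP; apply: eq_big_nat => k.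
by rewrite hz => /andP[xk _]; rewrite gtn_eqF.
Qed.


Hypothesis wcond : conductance w.
Hypothesis theta0 : forall x : G, 0 < theta x.

Definition conductivity (z : G) : R := Num.max 1 (mu w z / theta z).

Lemma conductivity_ge1 z : 1 <= conductivity z.
Proof. by rewrite /conductivity le_max lexx. Qed.

Lemma weight_le_mu y z : adj y z -> w y z <= mu w y.
Proof.
move=> yz; rewrite /mu (fsbigD1 z)//=; last exact: locally_finite.
by rewrite lerDl fsumr_ge0// => t [/= /wcond[/ltW]].
Qed.

(** The weight [w y z] is a summand of both [mu w y] and [mu w z], so the ratio of [theta] to
    [w y z] at either end is at least the inverse of the maximum; so is 1, as the maximum is at
    least 1. *)
Lemma step_length_ge y z : adj y z ->
  Num.max (conductivity y) (conductivity z) `^ (- 2^-1) <= step_length w theta y z.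
Proof.
move=> yz; have [wyz0 wC] := wcond yz.
set F := Num.max _ _.
have F1 : 1 <= F by rewrite le_max conductivity_ge1.
have F0 : 0 < F := lt_le_trans ltr01 F1.
have muF t : t = y \/ t = z -> mu w t <= F * theta t.
  move=> tyz; rewrite -ler_pdivrMr//.
  apply: (@le_trans _ _ (conductivity t)); first by rewrite le_max lexx orbT.
  by rewrite le_max; case: tyz => ->; rewrite lexx ?orbT.
have {}muF t : t = y \/ t = z -> F^-1 <= theta t / w y z.
  move=> tyz; rewrite ler_pdivlMr// mulrC ler_pdivrMr// mulrC.
  apply: le_trans (muF t tyz).
  by case: tyz => ->; rewrite ?weight_le_mu// wC weight_le_mu// adj_sym.
rewrite /step_length -powR12_sqrt; last first.
  by rewrite le_min ler01 divr_ge0 ?le_min ?ltW.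
have -> : F `^ (- 2^-1) = F^-1 `^ 2^-1.
  by rewrite -[F^-1]powR_inv1 ?ltW// -powRrM mulN1r.
apply: ge0_ler_powR; rewrite ?nnegrE ?invr_ge0 ?(ltW F0)//.
  by rewrite le_min ler01 divr_ge0 ?le_min ?ltW.
rewrite le_min invf_le1// F1 /=.
by rewrite minr_pMl ?invr_ge0 ?(ltW wyz0)// le_min !muF//; [right|left].
Qed.

(** The set [B] need not be the ball around [x], so that it can be a ball around another point,
    where the averaged norm is controlled. *)
Lemma walk_cost_ge (p S : R) (n : nat) (x : G) (s : seq G) (B : set G) :
  0 < p -> 0 < S -> (0 < n)%N -> path (@adj G) x s -> (n <= gdist x (last x s))%N ->
  finite_set B -> gball x n `<=` B ->
  \sum_(z \in B) conductivity z `^ p <= S ->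
  n%:R * (2 * S / n%:R) `^ (- (2 * p)^-1) <= walk_cost w theta x s.
Proof.
move=> p0 S0 n0 xs ns Bfin xB BS.
have [e] := walk_crossing (@gdist_adj G x) xs ns.
rewrite gdistxx => ek; apply: le_trans.
have cond0 z : 0 < conductivity z := lt_le_trans ltr01 (conductivity_ge1 z).
pose F k := Num.max (conductivity (e k).1) (conductivity (e k).2).
have F0 k : 0 < F k by rewrite lt_max cond0.
apply: (@le_trans _ _ (\sum_(0 <= k < n) (F k `^ p) `^ (- (2 * p)^-1))); last first.
  apply: ler_sum_nat => k kn; have [yz _ _] := ek k kn.
  apply: le_trans (step_length_ge yz).
  by rewrite -powRrM -/(F k) invfM mulrN mulrCA divff ?mulr1// gt_eqF.
apply: sum_powRN_ge => //; rewrite ?mulr_gt0 ?invr_ge0 ?mulr_ge0 ?(ltW p0)//.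
  by move=> k _; rewrite powR_gt0.
(* Vertices on distinct spheres are distinct. This serves the lower ends with [m = id] and the upper
   ends with [m = succn], whose levels stay at most [n]. *)
have sumB (u : nat -> G) (m : nat -> nat) : injective m ->
    (forall k, (k < n)%N -> gdist x (u k) = m k /\ (m k <= n)%N) ->
    \sum_(0 <= k < n) conductivity (u k) `^ p <= S.
  move=> minj um; apply: le_trans BS.
  apply: (ler_sum_inj (F := fun z => conductivity z `^ p)) => //.
  - by move=> z; apply: powR_ge0.
  - by move=> k /um[uk kn]; apply: xB; rewrite /gball/= uk.
  - by move=> i j /um[ui _] /um[uj _] uij; apply: minj; rewrite -ui -uj uij.
rewrite (mulr_natl S 2) mulr2n.
apply: (@le_trans _ _ (\sum_(0 <= k < n) (conductivity (e k).1 `^ p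
    + conductivity (e k).2 `^ p))).
  apply: ler_sum_nat => k _; rewrite /F.
  by case: (leP (conductivity _)) => _; rewrite ?lerDl ?lerDr powR_ge0.
rewrite big_split/= lerD//.
- by apply: (sumB _ id) => // k kn; have [_ -> _] := ek k kn; split=> //; apply: ltnW.
- by apply: (sumB _ succn) => [? ? []|k kn] //; have [_ _ ->] := ek k kn.
Qed.

End Walks.

(** * From the limsup to sums over balls, and the conclusion *)

Lemma m_limsup_lt (R : realType) (G : graph) (w : G -> G -> R) theta p x M :
  (m_limsup w theta p x < M%:E)%E -> exists N, forall n, (N <= n)%N ->
  avg_norm p (gball x n) (conductivity w theta) <= M.
Proof.
rewrite /m_limsup /limn_esup limf_esupE => /ereal_inf_lt[_ [A [N _ NA] <-] /ltW supM].
exists N => n Nn; rewrite -lee_fin; apply: le_trans supM.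
by apply: ereal_sup_ubound; exists n => //; apply: NA.
Qed.

Lemma avg_norm_sum_le (R : realType) (G : graph) (p M : R) (B : set G) (f : G -> R) :
  0 < p -> (0 < Defs.card B)%N -> (forall z, 0 <= f z) -> avg_norm p B f <= M ->
  \sum_(z \in B) f z `^ p <= (Defs.card B)%:R * M `^ p.
Proof.
move=> p0 B0 f0; rewrite /avg_norm.
under eq_fsbigr do rewrite ger0_norm//.
set T := \sum_(_ \in _) _ => TM.
have T0 : 0 <= (Defs.card B)%:R^-1 * T.
  by rewrite mulr_ge0// fsumr_ge0// => z _; apply: powR_ge0.
rewrite -ler_pdivrMl ?ltr0n//.
(* The mean is the [p]-th power of its [p]-th root, which [TM] bounds. *)
rewrite -[leLHS](powRr1 T0) -[X in _ `^ X <= _](@mulVf _ p) ?gt_eqF// powRrM.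
apply: ge0_ler_powR; rewrite ?nnegrE ?powR_ge0 ?(ltW p0)//.
by rewrite (le_trans (powR_ge0 _ _) TM).
Qed.

Theorem theorem2p4 (R : realType) (Cdeg d Creg d' CS1 p : R)
    (hCdeg : 1 <= Cdeg) (hd : 2 <= d) (hCreg : 0 < Creg)
    (hd' : d <= d') (hCS1 : 0 < CS1) (hp : (d - 1) / 2 < p) :
  exists c : R -> R, (forall m : R, 0 < c m) /\
    forall (G : graph) (w : G -> G -> R) (theta : G -> R),
      condG1 G Cdeg -> condG2 G d Creg -> condG3 G d d' CS1 ->
      conductance w -> (forall x : G, 0 < theta x) ->
      (forall x : G, (m_limsup w theta p x < +oo)%E) ->
      (* the limsup may depend on its base point: c may be evaluated at any of
         its values, and then works for all x *)
      forall (x0 : G) (m_p : R), m_limsup w theta p x0 = m_p%:E ->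
      forall x : G, exists N3 : nat, forall y : G, (N3 <= gdist x y)%N ->
        c m_p * (gdist x y)%:R `^ (1 - (d - 1) / (2 * p)) <= dtheta w theta x y.
Proof.
have p0 : 0 < p by lra.
pose K (m : R) := Creg * 2 `^ d * (`|m| + 1) `^ p.
have K0 m : 0 < K m by rewrite !mulr_gt0 ?powR_gt0// ltr_wpDl.
exists (fun m => (2 * K m) `^ (- (2 * p)^-1)); split=> [m|].
  by rewrite powR_gt0// mulr_gt0.
move=> G w theta _ G2 _ wcond theta0 _ x0 m mE x.
have [N avgN] : exists N, forall n, (N <= n)%N ->
    avg_norm p (gball x0 n) (conductivity w theta) <= `|m| + 1.
  by apply: m_limsup_lt; rewrite mE lte_fin (le_lt_trans (ler_norm m))// ltrDl.
have [N1 volN1] := G2 x0.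
(* Beyond this distance [n], the ball of radius [2n] around [x0] contains the ball of radius [n]
   around [x], and [2n] exceeds both [N] and [N1]; the successor makes [n] positive. *)
exists (N + N1 + gdist x0 x).+1 => y; set n := gdist x y => Nn.
have n0 : (0 < n)%N by apply: leq_trans Nn.
have nR0 : 0 < n%:R :> R by rewrite ltr0n.
have nn : (n <= n + n)%N by rewrite leq_addr.
have /andP[vol_ge vol_le] : Creg^-1 * (n + n)%:R `^ d
    <= (Defs.card (gball x0 (n + n)))%:R <= Creg * (n + n)%:R `^ d.
  by apply: volN1; lia.
have B0 : (0 < Defs.card (gball x0 (n + n)))%N.
  rewrite -(ltr0n R); apply: lt_le_trans vol_ge.
  by rewrite mulr_gt0 ?invr_gt0 ?powR_gt0// ltr0n; lia.
have sumB : \sum_(z \in gball x0 (n + n)) conductivity w theta z `^ p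
    <= K m * n%:R `^ d.
  have Nnn : (N <= n + n)%N by lia.
  have cond0 z : 0 <= conductivity w theta z.
    exact: le_trans ler01 (conductivity_ge1 w theta z).
  apply: le_trans (avg_norm_sum_le p0 B0 cond0 (avgN _ Nnn)) _.
  rewrite /K [leRHS]mulrAC ler_wpM2r ?powR_ge0//.
  by rewrite -mulrA -powRM// mulr_natl mulr2n -natrD.
have lower s : walk (@adj G) x y s ->
    n%:R * (2 * (K m * n%:R `^ d) / n%:R) `^ (- (2 * p)^-1) <= walk_cost w theta x s.
  move=> [xs sy]; apply: (walk_cost_ge wcond theta0) sumB => //.
  - by rewrite mulr_gt0 ?powR_gt0.
  - by rewrite sy.
  - exact: gball_finite.
  - by apply: sub_gball; lia.
have -> : (2 * K m) `^ (- (2 * p)^-1) * n%:R `^ (1 - (d - 1) / (2 * p))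
    = n%:R * (2 * (K m * n%:R `^ d) / n%:R) `^ (- (2 * p)^-1).
  have -> : 2 * (K m * n%:R `^ d) / n%:R = 2 * K m * n%:R `^ (d - 1).
    by rewrite powRB ?(gt_eqF nR0) ?implybT// powRr1 ?ltW// !mulrA.
  have K2 : 0 <= 2 * K m by rewrite mulr_ge0// ltW.
  rewrite (powRM _ K2 (powR_ge0 _ _)) [RHS]mulrCA; congr (_ * _).
  by rewrite -powRrM mulrN powRD ?(gt_eqF nR0) ?implybT// powRr1 ?ltW.
(* A lower bound passes to [inf] only for a nonempty set, which connectedness provides. *)
apply: lb_le_inf => [|_ [s xys <-]]; last exact: lower.
have [s xys] := connected_graph x y.
by exists (walk_cost w theta x s), s.
Qed.
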